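(* Let $n=6q$ for some odd positive integer $q$. Let $X$ be a Hadamard graph on $4n^2$ vertices (i.e. arising from a Hadamard matrix of order $n^2$), and let $Y$ be a distance-regular antipodal double cover of $K_{36}$ with $\delta=2$. Let $a,b$ be antipodal vertices of $X$ and $c,d$ antipodal vertices of $Y$. Then in the Cartesian product $X\,\square\,Y$: (i) Laplacian perfect state transfer occurs from $(a,c)$ to $(b,c)$ and from $(a,d)$ to $(b,d)$ at time $\pi/2$; (ii) proper Laplacian fractional revival occurs from $(a,c)$ to $(a,d)$ and from $(b,c)$ to $(b,d)$ at time $\pi/3$.
   Context: For a graph with adjacency matrix $A$ and diagonal degree matrix $D$, the Laplacian is $L=D-A$ and the transition matrix is $U(t)=\exp(itL)$. Laplacian fractional revival from $u$ to $v\neq u$ at time $\tau$ means $U(\tau)e_u=\alpha e_u+\beta e_v$ for complex $\alpha,\beta$; it is proper if $\beta\ne0$ and is Laplacian perfect state transfer if $\alpha=0$. Given an $N\times N$ Hadamard matrix $H$ ($\pm1$ entries, $HH^T=NI$), the Hadamard graph has $4N$ vertices $r_i^+,r_i^-,c_i^+,c_i^-$ ($1\le i\le N$), where $r_i^{+}\sim c_j^{+}$ and $r_i^-\sim c_j^-$ if $H_{ij}=1$, and $r_i^{+}\sim c_j^{-}$ and $r_i^-\sim c_j^+$ if $H_{ij}=-1$; it is distance-regular of diameter 4, and antipodal vertices are vertices at distance 4 (e.g. $r_i^+,r_i^-$). A distance-regular antipodal double cover of $K_m$ is a distance-regular graph of diameter 3 on $2m$ vertices whose vertex set is partitioned into $m$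 pairs of vertices at distance 3 (antipodal pairs), such that collapsing each pair yields $K_m$; its parameter $\delta$ is $a_1-c_2$, where $a_1$ is the number of common neighbours of two adjacent vertices and $c_2$ that of two vertices at distance 2. Antipodal vertices $c,d$ are the two vertices of one pair. The Cartesian product $X\,\square\,Y$ has vertex set $V(X)\times V(Y)$, with $(x_1,y_1)\sim(x_2,y_2)$ iff either $x_1\sim x_2$ and $y_1=y_2$, or $x_1=x_2$ and $y_1\sim y_2$. *)

(* Defs.v *)
From HB Require Import structures.
From mathcomp Require Export all_boot all_order all_algebra.
From mathcomp Require Export complex.
From mathcomp Require Export all_classical all_reals topology normedtype sequences trigo.

Set Implicit Arguments.
Unset Strict Implicit.
Unset Printing Implicit Defensive.

Import Order.TTheory GRing.Theory Num.Theory.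
Import numFieldNormedType.Exports.

Local Open Scope ring_scope.
Local Open Scope complex_scope.

Section Graphs.
Variable V : finType.
Implicit Types (adj : rel V) (x y : V).

Definition simple_graph adj : Prop := symmetric adj /\ irreflexive adj.

Definition walk adj (k : nat) x y : bool :=
  [exists p : k.-tuple V, path adj x p && (last x p == y)].

Definition at_distance adj (k : nat) x y : bool :=
  walk adj k x y && [forall j : 'I_k, ~~ walk adj j x y].

(* In particular, a graph with a diameter is connected. *)
Definition has_diameter adj (d : nat) : Prop :=
  (forall x y, exists2 k, (k <= d)%N & at_distance adj k x y) /\
  (exists x y, at_distance adj d x y).

Definition common_neighbours adj x y : nat := #|[set z | adj x z & adj y z]|.

(* p i j k is the intersection number p_{ij}^k. *)
Definition distance_regular adj : Prop :=
  [/\ simple_graph adj,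
      forall x y, connect adj x y
    & exists p : nat -> nat -> nat -> nat, forall i j k x y,
        at_distance adj k x y ->
        #|[set z | at_distance adj i x z & at_distance adj j z y]| = p i j k].

(* P is the partition of the vertex set into antipodal pairs. *)
Definition antipodal_double_cover adj (m : nat) : Prop :=
  [/\ distance_regular adj,
      has_diameter adj 3,
      #|V| = (2 * m)%N
    & exists P : {set {set V}},
        [/\ finset.partition P [set: V],
            #|P| = m,
            forall B, B \in P -> #|B| = 2%N,
            forall x y, at_distance adj 3 x y <->
              x != y /\ finset.pblock P x = finset.pblock P y
          & forall B C, B \in P -> C \in P -> B != C ->
              exists x y, [/\ x \in B, y \in C & adj x y]]].

Definition has_delta adj (delta : int) : Prop :=
  exists a1 c2 : nat,
    [/\ forall x y, adj x y -> common_neighbours adj x y = a1,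
        forall x y, at_distance adj 2 x y -> common_neighbours adj x y = c2
      & delta = a1%:Z - c2%:Z].

End Graphs.

Definition cartesian_product (V W : finType) (e : rel V) (f : rel W) :
    rel (V * W) :=
  fun u v => e u.1 v.1 && (u.2 == v.2) || (u.1 == v.1) && f u.2 v.2.

Definition hadamard_mx (N : nat) (H : 'M[int]_N) : Prop :=
  (forall i j, H i j = 1 \/ H i j = -1) /\ H *m H^T = (N%:R)%:M.

(* inl (i, s) is r_i^s and inr (j, t) is c_j^t, the sign + being true. *)
Definition hadamard_vertex (N : nat) : finType :=
  (('I_N * bool) + ('I_N * bool))%type.

Definition hadamard_graph (N : nat) (H : 'M[int]_N) : rel (hadamard_vertex N) :=
  fun u v =>
    match u, v with
    | inl (i, s), inr (j, t) | inr (j, t), inl (i, s) =>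
        H i j == (if s == t then 1 else -1)
    | _, _ => false
    end.

Definition mexp (K : numFieldType) (n : nat) (A : 'M[K]_n) : 'M[K]_n :=
  limn (series (fun k => (k`!%:R)^-1 *: A ^+ k)).

(* Matrices and vectors indexed by a finite type V use the enumeration of V. *)
Section LaplacianWalk.
Variables (R : realType) (V : finType).
Implicit Types (adj : rel V) (u v : V) (t : R).

Definition adjacency_mx adj : 'M[R[i]]_#|V| :=
  \matrix_(i, j) (adj (enum_val i) (enum_val j))%:R.

Definition degree_mx adj : 'M[R[i]]_#|V| :=
  diag_mx (\row_i (#|[set y | adj (enum_val i) y]|)%:R).

Definition laplacian adj : 'M[R[i]]_#|V| := degree_mx adj - adjacency_mx adj.

Definition transition adj t : 'M[R[i]]_#|V| :=
  mexp ((0 +i* t) *: laplacian adj).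

Definition basis_vec u : 'cV[R[i]]_#|V| := delta_mx (enum_rank u) 0.

Definition fractional_revival adj u v t (alpha beta : R[i]) : Prop :=
  u != v /\
  transition adj t *m basis_vec u =
    alpha *: basis_vec u + beta *: basis_vec v.

Definition proper_fractional_revival adj u v t : Prop :=
  exists alpha beta : R[i],
    fractional_revival adj u v t alpha beta /\ beta != 0.

Definition perfect_state_transfer adj u v t : Prop :=
  exists alpha beta : R[i],
    fractional_revival adj u v t alpha beta /\ alpha = 0.

End LaplacianWalk.

(* Main.v *)
(* All Laplacian eigenvalues involved are integers: with N = n^2 they are 0, N,
   2N and N - n, N + n for X, and 0, 36 and 28, 40 for Y, where the first group
   belongs to vectors that are even under the antipodal map and the second to
   odd ones.  So exp(itL) acts on a sum of eigenvectors through powers of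
   z = exp(it), and on the product it acts as the tensor product of the two
   walks.  At z = i (t = pi/2) the X-walk is 1 on even and -1 on odd vectors,
   that is, the antipodal map, while the Y-walk is the identity.  At
   z = exp(i pi/3) the X-walk is the identity, while the Y-walk is 1 on even and
   z^4 on odd vectors, so it maps e_c to
   (1 + z^4)/2 e_c + (1 - z^4)/2 e_d, and z^4 <> 1. *)
From HB Require Import structures.
Require Import Defs.
From mathcomp Require Import ring lra zify.

Set Implicit Arguments.
Unset Strict Implicit.
Unset Printing Implicit Defensive.

Import Order.TTheory GRing.Theory Num.Theory.
Import numFieldNormedType.Exports.

Local Open Scope ring_scope.
Local Open Scope complex_scope.

(** * The complex exponential on the imaginary axis *)

Section Cis.
Local Open Scope classical_set_scope.
Variable R : realType.
Implicit Types x y t : R.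
Local Notation C := (Num.NumField.sort (R[i] : numFieldType)).

Lemma complex_eq (z w : R[i]) :
  complex.Re z = complex.Re w -> complex.Im z = complex.Im w -> z = w.
Proof. by case: z w => [? ?] [? ?] /= -> ->. Qed.

Definition cis t : R[i] := cos t +i* sin t.

Lemma cisD x y : cis (x + y) = cis x * cis y.
Proof. by apply: complex_eq; rewrite /= ?cosD ?sinD //; ring. Qed.

Lemma cis_natmul t k : cis (t *+ k) = cis t ^+ k.
Proof.
elim: k => [|k IH]; first by rewrite mulr0n expr0 /cis cos0 sin0.
by rewrite mulrS exprS cisD IH.
Qed.

Lemma cis_pihalf : cis (pi / 2) = 'i.
Proof. by rewrite /cis cos_pihalf sin_pihalf. Qed.

Lemma cis_pithird3 : cis (pi / 3) ^+ 3 = -1.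
Proof.
have -> : cis (pi / 3) ^+ 3 = cis pi by rewrite -cis_natmul; congr cis; field.
by apply: complex_eq; rewrite /= ?cospi ?sinpi ?oppr0.
Qed.

Lemma cis_pithird_neqN1 : cis (pi / 3) != -1.
Proof.
have pi0 := pi_gt0 R.
apply/eqP => /(congr1 (@complex.Im R)) /= /eqP; rewrite oppr0 gt_eqF //.
by apply: sin_gt0_pi; lra.
Qed.

Lemma cvg_real_complex (u : nat -> R) (l : R) :
  u @ \oo --> l -> (fun n => (u n)%:C : C) @ \oo --> (l%:C : C).
Proof.
move=> /cvgrPdist_lt ul; apply/cvgrPdist_lt => e.
(* In the order on [R[i]], a positive [e] has zero imaginary part, so its real part serves as the
   real epsilon. *)
rewrite ltcE /= => /andP[/eqP eI eR].
have := ul _ eR; apply: filterS => n.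
rewrite -rmorphB normc_def /= expr0n addr0 sqrtr_sqr => h.
by rewrite ltcE /= eI eqxx.
Qed.

Lemma i_expr_double k : ('i : R[i]) ^+ k.*2 = ((-1) ^+ k)%:C.
Proof. by rewrite -muln2 mulnC exprM sqr_i rmorphXn rmorphN1. Qed.

Lemma exp_cis t :
  (* The powers of ['i] separate each partial sum into a partial cosine sum and ['i] times a partial
     sine sum, whose limits are known over the reals. *)
  series (fun k => (k`!%:R)^-1 * (0 +i* t) ^+ k : C) @ \oo --> (cis t : C).
Proof.
have -> : cis t = (cos t)%:C + 'i * (sin t)%:C by apply: complex_eq => /=; ring.
have -> : series (fun k => (k`!%:R)^-1 * (0 +i* t) ^+ k : C) =
    (fun m =>
       (series (cos_coeff t) m)%:C + 'i * (series (sin_coeff t) m)%:C : C).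
  apply/funext => m; rewrite !seriesEnat /= !rmorph_sum mulr_sumr -big_split /=.
  apply: eq_bigr => k _; rewrite /cos_coeff /sin_coeff.
  have -> : 0 +i* t = 'i * t%:C by apply: complex_eq => /=; ring.
  rewrite exprMn -(rmorphXn (real_complex R)) -[k in 'i ^+ k]odd_double_half.
  rewrite exprD i_expr_double.
  have -> : (k`!%:R : R[i])^-1 = (k`!%:R^-1)%:C by rewrite fmorphV rmorph_nat.
  case: (boolP (odd k)) => ok /=.
    (* [sin_coeff] takes its sign from [(k.-1)./2], while splitting off the parity of [k] leaves
       [k./2]. *)
    have -> : (k.-1)./2 = k./2.
      by rewrite -[in LHS](odd_double_half k) ok add1n /= doubleK.
    rewrite ok expr1 mulr1n mulr0n -exprnP; apply: complex_eq => /=; ring.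
  rewrite (negPf ok) expr0 mulr1n mulr0n -exprnP; apply: complex_eq => /=; ring.
apply: cvgD.
  by apply: cvg_real_complex; rewrite unlock; exact: is_cvg_series_cos_coeff.
apply: cvgMl_tmp; apply: cvg_real_complex; rewrite unlock.
exact: is_cvg_series_sin_coeff.
Qed.

End Cis.

(** * Entrywise limits of matrices *)

Section MatrixLimits.
Local Open Scope classical_set_scope.

(** A neighbourhood of [M] contains a box of neighbourhoods of its entries, and a filter is closed
    under the finite intersection over all indices. *)
Lemma cvg_mx (T : topologicalType) (S : Type) (F : set_system S) (m n : nat)
    (f : S -> 'M[T]_(m, n)) (M : 'M[T]_(m, n)) : Filter F ->
  (forall i j, (fun s => f s i j) @ F --> M i j) -> f @ F --> M.
Proof.
move=> FF fM A [P MP PA].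
have : \forall s \near F, forall i j, P i j (f s i j).
  by apply: filter_forall => i; apply: filter_forall => j; exact: fM (MP i j).
by apply: filterS => s Ps; apply: PA.
Qed.

Lemma mexp_eq (K : numFieldType) (n : nat) (A M : 'M[K]_n) :
  (forall i j, (fun m => series (fun k => (k`!%:R)^-1 *: A ^+ k) m i j) @ \oo
               --> M i j) ->
  mexp A = M.
Proof. by move=> AM; apply: cvg_lim; [exact: norm_hausdorff|exact: cvg_mx]. Qed.

End MatrixLimits.

(** * Evolution under the Laplacian, as a relation on vertex functions *)

Section Evolution.
Variables (F : fieldType) (V : finType) (adj : rel V).
Implicit Types (g h : {ffun V -> F^o}).

Definition lap g : {ffun V -> F^o} :=
  [ffun x => \sum_(y | adj x y) (g x - g y)].

Definition point (u : V) : {ffun V -> F^o} := [ffun x => (x == u)%:R].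

(* With [z = exp (i t)] this says that [exp (i t L)] maps [g] to [h]; integral
   eigenvalues are enough here, and they keep the phases algebraic. *)
Inductive evolves (z : F) : {ffun V -> F^o} -> {ffun V -> F^o} -> Prop :=
| evolves_eigen g (k : nat) : lap g = k%:R *: g -> evolves z g (z ^+ k *: g)
| evolves_add g h g' h' :
    evolves z g h -> evolves z g' h' -> evolves z (g + g') (h + h')
| evolves_scale a g h : evolves z g h -> evolves z (a *: g) (a *: h).

End Evolution.
Arguments point F {V} u.

(** * The Laplacian of a Cartesian product *)

Section Product.
Variables (F : fieldType) (V W : finType) (e : rel V) (f : rel W).

Definition tensor (g : {ffun V -> F^o}) (h : {ffun W -> F^o}) :
  {ffun V * W -> F^o} :=
  [ffun p => g p.1 * h p.2].

Lemma tensor_point u w : tensor (point F u) (point F w) = point F (u, w).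
Proof.
by apply/ffunP => -[x y]; rewrite !ffunE /= xpair_eqE -natrM mulnb.
Qed.

Lemma tensorDl g g' h : tensor (g + g') h = tensor g h + tensor g' h.
Proof. by apply/ffunP => p; rewrite !ffunE mulrDl. Qed.

Lemma tensorDr g h h' : tensor g (h + h') = tensor g h + tensor g h'.
Proof. by apply/ffunP => p; rewrite !ffunE mulrDr. Qed.

Lemma tensorZl a g h : tensor (a *: g) h = a *: tensor g h.
Proof. by apply/ffunP => p; rewrite !ffunE scalerAl. Qed.

Lemma tensorZr a g h : tensor g (a *: h) = a *: tensor g h.
Proof. by apply/ffunP => p; rewrite !ffunE scalerAr. Qed.

Lemma lap_tensor g h :
  lap (cartesian_product e f) (tensor g h) =
  tensor (lap e g) h + tensor g (lap f h).
Proof.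
apply/ffunP => -[x y]; rewrite !ffunE /=.
(* Only at the diagonal can both adjacencies hold, and there all terms vanish. *)
have split_term x' y' :
    (if cartesian_product e f (x, y) (x', y') then g x * h y - g x' * h y'
     else 0) =
    (if y' == y then if e x x' then (g x - g x') * h y else 0 else 0) +
    (if x' == x then if f y y' then g x * (h y - h y') else 0 else 0).
  rewrite /cartesian_product /= (eq_sym x) (eq_sym y).
  case: (eqVneq x' x) => [->|_]; case: (eqVneq y' y) => [->|_];
    rewrite ?andbT ?andbF ?orbF ?subrr ?mul0r ?mulr0 ?if_same ?addr0 ?add0r //=.
    by rewrite mulrBr.
  by rewrite mulrBl.
rewrite big_mkcond /=.
transitivity (\sum_x' \sum_y'
    ((if y' == y then if e x x' then (g x - g x') * h y else 0 else 0) +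
     (if x' == x then if f y y' then g x * (h y - h y') else 0 else 0))).
  by rewrite pair_big; apply: eq_bigr => -[x' y'] _; rewrite ffunE -split_term.
under [LHS]eq_bigr => x' _ do rewrite big_split /= -big_mkcond big_pred1_eq.
rewrite big_split /= -big_mkcond mulr_suml; congr (_ + _).
rewrite (bigD1 x) //= [X in _ + X]big1 => [|x' /negPf ->]; last by rewrite big1.
rewrite addr0 mulr_sumr [RHS]big_mkcond /=.
by apply: eq_bigr => y' _; rewrite eqxx.
Qed.

(** The product Laplacian is a Kronecker sum: eigenvalues of tensor factors add, so their phases
    multiply. Bilinearity of [tensor] gives the other cases. *)
Lemma evolves_tensor z g h g' h' :
  evolves e z g h -> evolves f z g' h' ->
  evolves (cartesian_product e f) z (tensor g g') (tensor h h').
Proof.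
move=> gh gh'; elim: gh => {g h} [g k gk|g1 h1 g2 h2 _ IH1 _ IH2|a g h _ IH].
- elim: gh' => {g' h'} [g' k' gk'|g1 h1 g2 h2 _ IH1 _ IH2|a g' h' _ IH].
  + rewrite tensorZl tensorZr scalerA -exprD; apply: evolves_eigen.
    by rewrite lap_tensor gk gk' tensorZl tensorZr -scalerDl natrD.
  + by rewrite !tensorDr; apply: evolves_add.
  + by rewrite !tensorZr; apply: evolves_scale.
- by rewrite !tensorDl; apply: evolves_add.
- by rewrite !tensorZl; apply: evolves_scale.
Qed.

End Product.

(** * From evolution of functions to the transition matrix *)

Section Transition.
Local Open Scope classical_set_scope.
Variables (R : realType) (V : finType) (adj : rel V).
Local Notation C := (Num.NumField.sort (R[i] : numFieldType)).
Implicit Types g h : {ffun V -> R[i]^o}.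

Definition col_ffun g : 'cV[R[i]]_#|V| := \col_i g (enum_val i).

Lemma col_ffun_point u : col_ffun (point _ u) = basis_vec R u.
Proof.
apply/colP => i; rewrite !mxE ffunE eqxx andbT.
by rewrite -(inj_eq enum_rank_inj) enum_valK.
Qed.

Lemma col_ffunD g h : col_ffun (g + h) = col_ffun g + col_ffun h.
Proof. by apply/colP => i; rewrite !mxE !ffunE. Qed.

Lemma col_ffunZ a g : col_ffun (a *: g) = a *: col_ffun g.
Proof. by apply/colP => i; rewrite !mxE !ffunE. Qed.

Lemma mul_laplacian_col g :
  laplacian R adj *m col_ffun g = col_ffun (lap adj g).
Proof.
apply/colP => i; rewrite mulmxBl mul_diag_mx !mxE ffunE.
rewrite sumrB sumr_const; congr (_ - _).
  by rewrite mulr_natl; congr (_ *+ _); apply: eq_card => y; rewrite inE.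
rewrite [RHS](reindex (@enum_val V predT)) /=; last first.
  exact: onW_bij (enum_val_bij _).
rewrite [RHS]big_mkcond /=; apply: eq_bigr => j _; rewrite !mxE.
by case: ifP => _; rewrite ?mul1r ?mul0r.
Qed.

Definition exp_partial t m : 'M[R[i]]_#|V| :=
  series (fun k => (k`!%:R)^-1 *: ((0 +i* t) *: laplacian R adj) ^+ k) m.

Lemma exp_partial_eigen t m g k : lap adj g = k%:R *: g ->
  exp_partial t m *m col_ffun g =
  series (fun j => (j`!%:R)^-1 * (0 +i* (t *+ k)) ^+ j : R[i]) m *: col_ffun g.
Proof.
move=> gk; rewrite /exp_partial !seriesEnat /= mulmx_suml scaler_suml.
apply: eq_bigr => j _; rewrite -scalemxAl -scalerA; congr (_ *: _).
elim: j => [|j IH]; first by rewrite !expr0 mul1mx scale1r.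
rewrite !exprSr -mulmxE -mulmxA -scalemxAl mul_laplacian_col gk col_ffunZ.
rewrite scalerA -scalemxAr IH scalerA mulrC; congr (_ * _ *: _).
by apply: complex_eq; rewrite ?ReMn //=; rewrite mulr_natr ?raddfMn //= ?mul0rn.
Qed.

(** Soundness of [evolves]: on an eigenvector the matrix series is the scalar series of [exp_cis],
    and limits respect sums and multiples. *)
Lemma evolves_cvg t g h : evolves adj (cis t) g h ->
  forall i, (fun m => (exp_partial t m *m col_ffun g) i 0 : C) @ \oo
            --> (col_ffun h i 0 : C).
Proof.
elim=> {g h} [g k gk|g h g' h' _ IH _ IH'|a g h _ IH] i.
- rewrite -cis_natmul col_ffunZ mxE.
  under eq_fun do rewrite (exp_partial_eigen _ _ gk) mxE.
  by apply: cvgMr_tmp; exact: exp_cis.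
- rewrite !col_ffunD mxE.
  under eq_fun do rewrite mulmxDr mxE.
  exact: cvgD.
- rewrite !col_ffunZ mxE.
  under eq_fun do rewrite -scalemxAr mxE.
  by apply: cvgMl_tmp.
Qed.

(** [mexp] is a limit of whole matrices, so every column must be shown to converge before one can be
    read off. This is why the evolution of every [point] is assumed. *)
Lemma transition_evolves t (S : V -> {ffun V -> R[i]^o}) :
  (forall u, evolves adj (cis t) (point _ u) (S u)) ->
  forall u, transition adj t *m basis_vec R u = col_ffun (S u).
Proof.
move=> ev u.
have -> : transition adj t = \matrix_(i, j) S (enum_val j) (enum_val i).
  apply: mexp_eq => i j; have := evolves_cvg (ev (enum_val j)) (i := i).
  rewrite col_ffun_point !mxE /basis_vec enum_valK.
  by under eq_fun do rewrite -colE mxE.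
by rewrite -colE; apply/colP => i; rewrite !mxE enum_rankK.
Qed.

End Transition.

(** * Regular graphs: phases from adjacency equations *)

Section Regular.
Variables (F : numFieldType) (V : finType) (adj : rel V).
Implicit Types (g h : {ffun V -> F^o}).

Definition adjop g : {ffun V -> F^o} := [ffun x => \sum_(y | adj x y) g y].

Lemma adjop_is_linear : linear adjop.
Proof.
move=> a g h; apply/ffunP => x; rewrite !ffunE scaler_sumr -big_split /=.
by apply: eq_bigr => y _; rewrite !ffunE.
Qed.

HB.instance Definition _ := GRing.isLinear.Build F _ _ _ adjop adjop_is_linear.

Variable k : nat.
Hypothesis adj_regular : forall x, #|[set y | adj x y]| = k.

Lemma lap_regular g : lap adj g = k%:R *: g - adjop g.
Proof.
apply/ffunP => x; rewrite !ffunE sumrB sumr_const; congr (_ - _).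
rewrite [RHS]mulr_natl -(adj_regular x); congr (_ *+ _).
by apply: eq_card => y; rewrite [in RHS]inE.
Qed.

Lemma evolves_adj_eigen z g (j : nat) : adjop g = (k%:R - j%:R) *: g ->
  evolves adj z g (z ^+ j *: g).
Proof.
move=> gj; apply: evolves_eigen.
by rewrite lap_regular gj -scalerBl opprB addrC subrK.
Qed.

(** With [r] and [s] the adjacency eigenvalues for Laplacian eigenvalues [i] and [j], [g] is
    annihilated by [(A - r)(A - s)]. Hence [(A - s) g] and [(A - r) g] are eigenvectors for [r] and
    [s], their difference is [(r - s) g], and both get the phase [w]. *)
Lemma evolves_adj_quadratic z w g (i j : nat) :
  adjop (adjop g) =
    (k%:R - i%:R + (k%:R - j%:R)) *: adjop g -
    ((k%:R - i%:R) * (k%:R - j%:R)) *: g ->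
  i != j -> z ^+ i = w -> z ^+ j = w -> evolves adj z g (w *: g).
Proof.
set r := k%:R - i%:R; set s := k%:R - j%:R => gq ij zi zj.
have rs : r - s != 0.
  by rewrite /r /s opprB addrC addrA subrK subr_eq0 eqr_nat eq_sym.
have eigen_r : evolves adj z (adjop g - s *: g) (w *: (adjop g - s *: g)).
  rewrite -{}zi; apply: evolves_adj_eigen; rewrite linearB linearZ /= gq -/r.
  by apply/ffunP => x; rewrite !ffunE /GRing.scale /=; ring.
have eigen_s : evolves adj z (adjop g - r *: g) (w *: (adjop g - r *: g)).
  rewrite -{}zj; apply: evolves_adj_eigen; rewrite linearB linearZ /= gq -/s.
  by apply/ffunP => x; rewrite !ffunE /GRing.scale /=; ring.
have := evolves_scale (r - s)^-1
  (evolves_add eigen_r (evolves_scale (-1) eigen_s)).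
by congr evolves; apply/ffunP => x; rewrite !ffunE /GRing.scale /=; field.
Qed.

End Regular.

Lemma evolves_antipodal (F : numFieldType) (V : finType) (adj : rel V) (z w : F)
    (u v : V) :
  evolves adj z (point F u + point F v) (point F u + point F v) ->
  evolves adj z (point F u - point F v) (w *: (point F u - point F v)) ->
  evolves adj z (point F u)
    (((1 + w) / 2) *: point F u + ((1 - w) / 2) *: point F v).
Proof.
move=> ev od.
have := evolves_add (evolves_scale 2^-1 ev) (evolves_scale 2^-1 od).
by congr evolves; apply/ffunP => x; rewrite !ffunE /GRing.scale /=; field;
  rewrite ?pnatr_eq0.
Qed.

(** * Short walks and distances *)

Section Walks.
Variables (V : finType) (adj : rel V).

Lemma walkP k x y :
  reflect (exists2 p : seq V, size p = k & path adj x p && (last x p == y))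
          (walk adj k x y).
Proof.
apply: (iffP existsP) => [[p pP]|[p sp pP]].
  by exists p; rewrite ?size_tuple.
by move/eqP: sp => sp; exists (Tuple sp).
Qed.

Lemma walk0 x y : walk adj 0 x y = (x == y).
Proof.
apply/walkP/idP => [[[|//] _ /= ->] //|/eqP ->].
by exists [::]; rewrite //= eqxx.
Qed.

Lemma walk1 x y : walk adj 1 x y = adj x y.
Proof.
apply/walkP/idP => [[[|z [|//]] //= _ /andP[/andP[xz _] /eqP <-]] //|xy].
by exists [:: y]; rewrite //= xy eqxx.
Qed.

Lemma walk2 x y : walk adj 2 x y = [exists z, adj x z && adj z y].
Proof.
apply/walkP/existsP => [[[|z [|t [|//]]] //= _]|[z /andP[xz zy]]].
  by case/andP=> /and3P[xz zt _] /eqP <-; exists z; rewrite xz.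
by exists [:: z; y]; rewrite //= xz zy eqxx.
Qed.

Lemma at_distance_no_walk k j x y :
  at_distance adj k x y -> (j < k)%N -> ~~ walk adj j x y.
Proof. by case/andP=> _ /forallP nw jk; have := nw (Ordinal jk). Qed.

End Walks.

(** * Hadamard graphs *)

Section Hadamard.
Variables (N : nat) (H : 'M[int]_N).
Hypothesis H_hadamard : hadamard_mx H.
Hypothesis N_gt0 : (0 < N)%N.
Local Notation V := (hadamard_vertex N).
Local Notation P := ('I_N + 'I_N)%type.

(** A one-sided inverse of a square matrix is two-sided. The detour through [rat] allows division by
    [N]. *)
Lemma hadamard_mx_tr : hadamard_mx H^T.
Proof.
have [H_sign HHT] := H_hadamard; split=> [i j|]; first by rewrite mxE.
rewrite trmxK.
have Hu : map_mx (intr : int -> rat) H *m (N%:R^-1 *: map_mx intr H^T) = 1%:M.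
  rewrite -scalemxAr -map_mxM HHT map_scalar_mx scale_scalar_mx /= rmorph_nat.
  by rewrite mulVf // pnatr_eq0 -lt0n.
have /(congr1 ( *:%R N%:R)) := mulmx1C Hu.
rewrite -scalemxAl scalerA mulfV ?pnatr_eq0 -?lt0n // scale1r -map_mxM.
rewrite scale_scalar_mx mulr1 => e.
apply/matrixP => i j; apply: (@intr_inj rat).
move/matrixP: e => /(_ i j); rewrite !mxE => ->.
by rewrite rmorphMn /= rmorph_nat.
Qed.

(* A vertex is a row or column of H, its line, together with a sign. *)
Definition line (v : V) : P :=
  match v with inl (i, _) => inl i | inr (j, _) => inr j end.
Definition sign (v : V) : bool := match v with inl (_, s) | inr (_, s) => s end.
Definition vertex (p : P) (s : bool) : V :=
  match p with inl i => inl (i, s) | inr j => inr (j, s) end.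
Definition side (p : P) : bool := if p is inl _ then true else false.
Definition antipode (v : V) : V := vertex (line v) (~~ sign v).

Lemma vertexK p s : (line (vertex p s) = p) * (sign (vertex p s) = s).
Proof. by case: p. Qed.

Lemma line_signK v : vertex (line v) (sign v) = v.
Proof. by case: v => [] []. Qed.

Lemma vertex_eqE u v : (u == v) = (line u == line v) && (sign u == sign v).
Proof.
apply/eqP/andP => [->|[/eqP iuv /eqP suv]]; first by rewrite !eqxx.
by rewrite -[u]line_signK -[v]line_signK iuv suv.
Qed.

Definition sgn (R : pzRingType) (s : bool) : R := if s then 1 else -1.

(** The symmetric block matrix with zero diagonal blocks and off-diagonal blocks [H] and [H^T], of
    which the graph is a signed double cover. *)
Definition signed (p q : P) : int :=
  match p, q with
  | inl i, inr j | inr j, inl i => H i j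
  | _, _ => 0
  end.

Lemma hadamard_graphE u v :
  hadamard_graph H u v =
  (signed (line u) (line v) == sgn int (sign u) * sgn int (sign v)).
Proof.
by case: u v => [[i []]|[i []]] [[j []]|[j []]].
Qed.

Variant signed_spec p q : int -> Prop :=
| SignedSame of side p = side q : signed_spec p q 0
| SignedPos of side q = ~~ side p : signed_spec p q 1
| SignedNeg of side q = ~~ side p : signed_spec p q (-1).

Lemma signedP p q : signed_spec p q (signed p q).
Proof.
have [H_sign _] := H_hadamard.
case: p q => [i|i] [j|j] /=; first by constructor.
- by case: (eqVneq (H i j) 1) => [->|/eqP n1];
    [|case: (H_sign i j) => // ->]; constructor.
- by case: (eqVneq (H j i) 1) => [->|/eqP n1];
    [|case: (H_sign j i) => // ->]; constructor.
- by constructor.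
Qed.

Lemma sum_line (R : nmodType) (f : P -> R) :
  \sum_p f p = \sum_i f (inl i) + \sum_j f (inr j).
Proof. by rewrite big_sumType. Qed.

(** The square of the block matrix has diagonal blocks [H *m H^T] and [H^T *m H]; the second one
    calls for [hadamard_mx_tr]. *)
Lemma signed_orthogonal p r :
  \sum_q signed p q * signed q r = if p == r then N%:R else 0.
Proof.
have entry (M : 'M[int]_N) (i k : 'I_N) : hadamard_mx M ->
    \sum_j M i j * M k j = if i == k then N%:R else 0.
  case=> _ /matrixP/(_ i k); rewrite !mxE.
  under eq_bigr do rewrite mxE.
  by move=> ->; case: eqP; rewrite ?mulr1n ?mulr0n.
rewrite sum_line; case: p r => [i|i] [k|k] /=.
- by rewrite big1 ?add0r ?entry // => j _; rewrite mul0r.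
- by rewrite !big1 ?addr0 // => j _; rewrite ?mulr0 ?mul0r.
- by rewrite !big1 ?addr0 // => j _; rewrite ?mulr0 ?mul0r.
- rewrite [X in _ + X]big1 ?addr0 => [|j _]; last by rewrite mul0r.
  rewrite -(entry _ i k hadamard_mx_tr); by apply: eq_bigr => j _; rewrite !mxE.
Qed.

Lemma sum_side (R : pzSemiRingType) s :
  \sum_(q : P | side q == s) (1 : R) = N%:R.
Proof.
rewrite big_mkcond sum_line.
by case: s; rewrite /= !sumr_const card_ord mul0rn ?addr0 ?add0r.
Qed.

(** The graph is bipartite, so [a] and [b] lie on the same side. Distinct lines on one side are
    orthogonal, which forces a common neighbour; so the lines coincide and only the signs differ. *)
Lemma hadamard_antipode a b :
  at_distance (hadamard_graph H) 4 a b -> b = antipode a.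
Proof.
move=> ab4.
have no_walk k : (k < 4)%N -> ~~ walk (hadamard_graph H) k a b.
  exact: at_distance_no_walk ab4.
have flip u v : hadamard_graph H u v -> side (line v) = ~~ side (line u).
  rewrite hadamard_graphE; case: signedP => //.
  by case: (sign u); case: (sign v).
have same : side (line b) = side (line a).
  case/andP: ab4 => /walkP[[|w1 [|w2 [|w3 [|w4 [|//]]]]] //= _].
  case/andP=> /and5P[h1 h2 h3 h4 _] /eqP <- _.
  by rewrite (flip _ _ h4) (flip _ _ h3) (flip _ _ h2) (flip _ _ h1) !negbK.
have aNb : a != b by have := no_walk 0%N isT; rewrite walk0.
case: (eqVneq (line a) (line b)) => [ab|aNb'].
  rewrite /antipode ab -[LHS]line_signK; congr vertex.
  case: (eqVneq (sign a) (sign b)) => [sab|]; last first.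
    by case: (sign a) (sign b) => [] [].
  by rewrite -[a]line_signK -[b]line_signK ab sab eqxx in aNb.
have := signed_orthogonal (line a) (line b); rewrite (negPf aNb').
have no2 w : ~~ (hadamard_graph H a w && hadamard_graph H w b).
  by have := no_walk 2%N isT; rewrite walk2 negb_exists => /forallP.
(* Some vertex of line [q] is a common neighbour exactly when the product of the two entries at [q]
   is [- c]. Without one, all [N] products equal [c], and their sum cannot vanish. *)
pose c := - (sgn int (sign a) * sgn int (sign b)).
rewrite (eq_bigr (fun q => if side q == ~~ side (line a) then c else 0)).
  rewrite -big_mkcond /= (eq_bigr (fun _ => 1 * c)) => [|q _]; last first.
    by rewrite mul1r.
  rewrite -mulr_suml sum_side /c => /eqP.
  rewrite mulf_eq0 pnatr_eq0 (negPf (lt0n_neq0 N_gt0)).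
  by case: (sign a) (sign b) => [] [].
move=> q _.
have n1 := no2 (vertex q true); have n2 := no2 (vertex q false).
move: n1 n2; rewrite !hadamard_graphE !vertexK /c.
by case: signedP => qa; case: signedP => qb; move: qa qb; rewrite same;
  case: (side (line a)); case: (side q) => //;
  case: (sign a); case: (sign b).
Qed.

Section Lifts.
Variable F : numFieldType.
Implicit Types f : P -> F.

Definition lift_even f : {ffun V -> F^o} := [ffun v => f (line v)].
Definition lift_odd f : {ffun V -> F^o} :=
  [ffun v => sgn F (sign v) * f (line v)].

Local Notation A := (@adjop F V (hadamard_graph H)).

Lemma sum_vertex (f : V -> F) :
  \sum_v f v = \sum_p (f (vertex p true) + f (vertex p false)).
Proof.
rewrite (reindex (fun ps : P * bool => vertex ps.1 ps.2)) /=; last first.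
  exists (fun v => (line v, sign v)) => [[p s] _|v _] /=; last first.
    exact: line_signK.
  by rewrite !vertexK.
rewrite -(pair_bigA _ (fun p s => f (vertex p s))) /=.
by apply: eq_bigr => p _; rewrite big_bool.
Qed.

(** Whatever the sign of the entry, each line of the opposite side contains exactly one
    neighbour. *)
Lemma adjop_even f :
  A (lift_even f) =
  lift_even (fun p => \sum_(q | side q == ~~ side p) f q).
Proof.
apply/ffunP => v; rewrite !ffunE big_mkcond sum_vertex [RHS]big_mkcond /=.
apply: eq_bigr => q _; rewrite !ffunE !hadamard_graphE !vertexK.
case: signedP => [->|->|->]; case: (sign v); case: (side _);
  by rewrite ?eqxx /= ?addr0 ?add0r.
Qed.

(** The sign of the neighbour in line [q] is that of the vertex times the entry at [q]. *)
Lemma adjop_odd f :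
  A (lift_odd f) =
  lift_odd (fun p => \sum_q (signed p q)%:~R * f q).
Proof.
apply/ffunP => v; rewrite !ffunE big_mkcond sum_vertex mulr_sumr /=.
apply: eq_bigr => q _; rewrite !ffunE !hadamard_graphE !vertexK.
case: signedP => _; case: (sign v); rewrite /= ?addr0 ?add0r; ring.
Qed.

Lemma adjop_odd2 f : A (A (lift_odd f)) = N%:R *: lift_odd f.
Proof.
rewrite !adjop_odd; apply/ffunP => v; rewrite !ffunE /GRing.scale /= mulrCA.
congr (_ * _).
under eq_bigr do rewrite mulr_sumr.
rewrite exchange_big /= (bigD1 (line v)) //= [X in _ + X]big1 => [|r rv].
  rewrite addr0; under eq_bigr do rewrite mulrA -intrM.
  by rewrite -mulr_suml -rmorph_sum /= signed_orthogonal eqxx rmorph_nat.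
under eq_bigr do rewrite mulrA -intrM.
by rewrite -mulr_suml -rmorph_sum /= signed_orthogonal eq_sym (negPf rv) mul0r.
Qed.

Lemma adjop_even_side (f : bool -> F) :
  A (lift_even (f \o side)) = N%:R *: lift_even (f \o negb \o side).
Proof.
rewrite adjop_even; apply/ffunP => v; rewrite !ffunE /GRing.scale /=.
rewrite (eq_bigr (fun _ => 1 * f (~~ side (line v)))) => [|q /eqP -> //].
  by rewrite -mulr_suml sum_side.
by rewrite mul1r.
Qed.

(** After one application the function depends on the side only, and from then on [A] swaps the
    sides with a factor [N]. *)
Lemma adjop_even3 f : A (A (A (lift_even f))) = N%:R ^+ 2 *: A (lift_even f).
Proof.
rewrite adjop_even.
pose S s := \sum_(q | side q == ~~ s) f q.
rewrite -[lift_even _]/(lift_even (S \o side)) adjop_even_side linearZ /=.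
rewrite adjop_even_side scalerA -expr2; congr (_ *: _).
by apply/ffunP => v; rewrite !ffunE /= negbK.
Qed.

(** Applying [A] to the constant 1 counts neighbours in [F], where characteristic 0 makes the count
    faithful. *)
Lemma hadamard_regular v : #|[set y | hadamard_graph H v y]| = N.
Proof.
have /ffunP/(_ v) := adjop_even (fun _ => 1 : F).
rewrite !ffunE sum_side (eq_bigr (fun _ => 1)) => [|y _]; last by rewrite ffunE.
rewrite sumr_const => /eqP; rewrite eqr_nat => /eqP eN.
by rewrite -[RHS]eN; apply: eq_card => y; rewrite inE.
Qed.

(** Split [g] into [N^-2 A^2 g], with Laplacian eigenvalues 0 and [2N], and the rest, which [A]
    kills and which has eigenvalue [N]. All these phases are 1. *)
Lemma evolves_even z f : z ^+ N = 1 ->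
  evolves (hadamard_graph H) z (lift_even f) (lift_even f).
Proof.
move=> zN; set g := lift_even f.
have N0 : (N%:R : F) != 0 by rewrite pnatr_eq0 -lt0n.
have ev2 : evolves (hadamard_graph H) z (A (A g)) (1 *: A (A g)).
  apply: (evolves_adj_quadratic hadamard_regular (i := 0) (j := N + N)).
  - rewrite adjop_even3 linearZ /=.
    by apply/ffunP => v; rewrite !ffunE /GRing.scale /=; ring.
  - by rewrite eq_sym addn_eq0 negb_and -lt0n N_gt0.
  - by rewrite expr0.
  - by rewrite exprD zN mulr1.
have ev0 : evolves (hadamard_graph H) z (g - (N%:R ^- 2) *: A (A g))
    (z ^+ N *: (g - (N%:R ^- 2) *: A (A g))).
  apply: (evolves_adj_eigen hadamard_regular).
  rewrite linearB linearZ /= adjop_even3 scalerA mulVf ?expf_neq0 //.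
  by rewrite scale1r !subrr scale0r.
have := evolves_add ev0 (evolves_scale (N%:R ^- 2) ev2).
by rewrite zN !scale1r subrK.
Qed.

(** On odd functions [A^2 = n^2], so the adjacency eigenvalues are [n] and [-n]. *)
Lemma evolves_odd n z w f : (N = n ^ 2)%N ->
  z ^+ (N - n) = w -> z ^+ (N + n) = w ->
  evolves (hadamard_graph H) z (lift_odd f) (w *: lift_odd f).
Proof.
move=> Nn zm zp.
have n0 : (0 < n)%N by move: N_gt0; rewrite Nn expn_gt0 orbF.
have nN : (n <= N)%N by rewrite Nn leq_pmulr.
apply: (evolves_adj_quadratic hadamard_regular (i := N - n) (j := N + n)) => //.
  have Nn' : N%:R = n%:R ^+ 2 :> F by rewrite Nn natrX.
  rewrite adjop_odd2 natrB // natrD Nn'.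
  by apply/ffunP => v; rewrite !ffunE /GRing.scale /=; ring.
lia.
Qed.

Lemma hadamard_evolves n z w u : (N = n ^ 2)%N ->
  z ^+ N = 1 -> z ^+ (N - n) = w -> z ^+ (N + n) = w ->
  evolves (hadamard_graph H) z (point F u)
    (((1 + w) / 2) *: point F u + ((1 - w) / 2) *: point F (antipode u)).
Proof.
move=> Nn zN zm zp; pose f p : F := (p == line u)%:R.
apply: evolves_antipodal.
  (* Both combinations lift the indicator of the line of [u], the odd one up to the sign of [u]. *)
  have -> : point F u + point F (antipode u) = lift_even f; last first.
    exact: evolves_even.
  apply/ffunP => v; rewrite !ffunE !vertex_eqE !vertexK /f.
  by case: (line v == line u); case: (sign v); case: (sign u);
    rewrite /= ?addr0 ?add0r.
have -> : point F u - point F (antipode u) = sgn F (sign u) *: lift_odd f.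
  apply/ffunP => v; rewrite !ffunE !vertex_eqE !vertexK /f /GRing.scale /=.
  case: (line v == line u); case: (sign v); case: (sign u); rewrite /=; ring.
rewrite scalerA mulrC -scalerA; apply: evolves_scale; exact: evolves_odd zm zp.
Qed.

End Lifts.
End Hadamard.

(** * Antipodal double covers of complete graphs *)

(** Being at distance 3 means being the other element of a two-element cell of the partition. *)
Lemma cover_antipode (V : finType) (adj : rel V) (m : nat) :
  antipodal_double_cover adj m ->
  exists2 anti : V -> V, involutive anti &
    forall x y, at_distance adj 3 x y = (y == anti x).
Proof.
case=> _ _ _ [P [Ppart _ P2 P3 _]].
have [/eqP covP trivP _] := and3P Ppart.
have xP x : x \in finset.cover P by rewrite covP inE.
have : forall x, exists y, forall z, at_distance adj 3 x z = (z == y).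
  move=> x; have /P2/eqP/cards2P[a [b [ab pab]]] :
      finset.pblock P x \in P by rewrite pblock_mem.
  have dE z : at_distance adj 3 x z = (x != z) && (z \in finset.pblock P x).
    rewrite -eq_pblock //; apply/idP/andP => [/P3[-> ->] //|[xz /eqP pxz]].
    by apply/P3.
  have : x \in finset.pblock P x by rewrite mem_pblock.
  rewrite pab !inE => /orP[] /eqP ex; [exists b|exists a] => z;
    rewrite dE pab !inE ex.
    by case: (eqVneq z a) => [->|_]; rewrite ?eqxx ?(negPf ab) //= andbT.
  by case: (eqVneq z b) => [->|_];
    rewrite ?orbT ?orbF ?eqxx /= 1?eq_sym ?(negPf ab).
move/boolp.choice => [anti antiP]; exists anti => [x|//].
have /P3[xa pxa] : at_distance adj 3 x (anti x) by rewrite antiP.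
by apply/esym/eqP; rewrite -antiP; apply/P3; rewrite eq_sym.
Qed.

Section Cover.
Variables (V : finType) (adj : rel V) (m : nat).
Hypothesis cover : antipodal_double_cover adj m.
Variable anti : V -> V.
Hypothesis antiK : involutive anti.
Hypothesis dist3 : forall x y, at_distance adj 3 x y = (y == anti x).

Lemma cover_sym : symmetric adj. Proof. by case: cover => [[[]]]. Qed.
Lemma cover_irr : irreflexive adj. Proof. by case: cover => [[[]]]. Qed.

Lemma anti_no_walk k x : (k < 3)%N -> ~~ walk adj k x (anti x).
Proof. by apply: at_distance_no_walk; rewrite dist3. Qed.

Lemma anti_neq x : (anti x == x) = false.
Proof.
by have := anti_no_walk x (isT : (0 < 3)%N); rewrite walk0 eq_sym => /negPf.
Qed.

Lemma adj_anti x : adj x (anti x) = false.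
Proof.
by have := anti_no_walk x (isT : (1 < 3)%N); rewrite walk1 => /negPf.
Qed.

Lemma anti_no_common x y : adj x y -> adj y (anti x) = false.
Proof.
move=> xy; apply/negP => yx.
have := anti_no_walk x (isT : (2 < 3)%N).
by rewrite walk2 => /existsPn/(_ y); rewrite xy yx.
Qed.

Lemma dist1E x y : at_distance adj 1 x y = adj x y.
Proof.
rewrite /at_distance walk1; case xy: (adj x y) => //=.
apply/forallP => -[[|//] j]; rewrite walk0.
by apply: contraTneq xy => ->; rewrite cover_irr.
Qed.

Lemma dist2E x y :
  at_distance adj 2 x y =
  [&& x != y, ~~ adj x y & [exists z, adj x z && adj z y]].
Proof.
rewrite /at_distance walk2 andbC andbA; congr (_ && _).
apply/forallP/andP => [nw|[xy nxy] [[|[|//]] j]]; rewrite ?walk0 ?walk1 //.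
by have := nw ord0; have := nw (lift ord0 ord0); rewrite walk0 walk1.
Qed.

Lemma cover_cases x y :
  [\/ x = y, adj x y, at_distance adj 2 x y | y = anti x].
Proof.
have [_ [diam _] _ _] := cover.
have [[|[|[|[|//]]]] _ d] := diam x y.
- by case/andP: d; rewrite walk0 => /eqP; constructor.
- by rewrite dist1E in d; constructor.
- by constructor.
- by rewrite dist3 in d; constructor 4; apply/eqP.
Qed.

(* The intersection number p^2_{31} is not 0, because for the first and third
   vertices of a shortest path between antipodes it counts the endpoint. *)
Lemma dist2_anti x y : at_distance adj 2 x y -> adj (anti x) y.
Proof.
have [[_ _ [p p_inter]] [_ [a [b ab]]] _ _] := cover.
have p312 : (0 < p 3 1 2)%N.
  case/andP: (ab) => /walkP[[|u [|v [|w [|//]]]] //= _].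
  case/andP=> /and4P[au uv vw _] /eqP wb _; subst w.
  have nw k : (k < 3)%N -> ~~ walk adj k a b by exact: at_distance_no_walk ab.
  have d2 : at_distance adj 2 a v.
    rewrite dist2E; apply/and3P; split.
    - have := nw 1%N isT; rewrite walk1; by apply: contraNneq => ->.
    - apply: contraNN (nw 2 isT) => av; rewrite walk2.
      by apply/existsP; exists v; rewrite av vw.
    - by apply/existsP; exists u; rewrite au uv.
  rewrite -(p_inter _ _ _ _ _ d2) card_gt0; apply/finset.set0Pn; exists b.
  by rewrite inE ab dist1E cover_sym vw.
move=> d2; rewrite -(p_inter _ _ _ _ _ d2) card_gt0 in p312.
have /finset.set0Pn[z] := p312.
by rewrite inE dist3 dist1E => /andP[/eqP ->].
Qed.

(** Outside its antipodal pair, a vertex is at distance 1 or 2 from [x], and those at distance 2 are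
    the neighbours of [anti x]. *)
Lemma adj_anti_compl x y : x != y -> y != anti x -> adj (anti x) y = ~~ adj x y.
Proof.
move=> xy yx; have [/eqP|xy1|xy2|/eqP] := cover_cases x y.
- by rewrite (negPf xy).
- by rewrite xy1 cover_sym anti_no_common.
- by rewrite dist2_anti //; move: xy2; rewrite dist2E => /and3P[_ ->].
- by rewrite (negPf yx).
Qed.

Lemma adj_anti_dist2 x y : adj x y -> at_distance adj 2 (anti x) y.
Proof.
move=> xy; have [e|xy1|//|e] := cover_cases (anti x) y.
- by rewrite -e adj_anti in xy.
- by rewrite cover_sym anti_no_common in xy1.
- by rewrite e antiK cover_irr in xy.
Qed.

(** The [2m] vertices split into the pair of [x] and the neighbourhoods of [x] and [anti x], equal
    in size by distance-regularity. *)
Lemma cover_regular x : #|[set y | adj x y]| = m.-1.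
Proof.
have [[_ _ [p p_inter]] _ cardV _] := cover.
have deg u : #|[set y | adj u y]| = p 1%N 1%N 0%N.
  rewrite -(p_inter 1%N 1%N 0%N u u); last first.
    by rewrite /at_distance walk0 eqxx; apply/forallP => -[].
  by apply: eq_card => y; rewrite !inE !dist1E cover_sym [adj y u]cover_sym andbb.
have partV : [set: V] =
    [set x; anti x] :|: ([set y | adj x y] :|: [set y | adj (anti x) y]).
  apply/setP => y; rewrite !inE.
  have [->|xy] := eqVneq y x; first by [].
  have [->|yx] := eqVneq y (anti x); first by rewrite orbT.
  by rewrite /= adj_anti_compl ?orbN // eq_sym.
have : #|[set: V]| = (2 + (p 1%N 1%N 0%N + p 1%N 1%N 0%N))%N.
  rewrite partV cardsU cards2 eq_sym anti_neq [#|_ :|: [set y | _]|]cardsU !deg.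
  rewrite (_ : [set y | adj x y] :&: _ = finset.set0) ?cards0 ?subn0; last first.
    apply/setP => y; rewrite !inE; apply/negP => /andP[xy].
    by rewrite cover_sym anti_no_common.
  rewrite (_ : _ :&: _ = finset.set0) ?cards0 ?subn0 //.
  apply/setP => y; rewrite !inE; apply/negP => /andP[/orP[] /eqP ->].
    by rewrite cover_irr cover_sym adj_anti.
  by rewrite cover_irr adj_anti.
rewrite cardsT cardV deg; lia.
Qed.

Section CoverEvolution.
Variable F : numFieldType.
Local Notation A := (@adjop F V adj).
Local Notation even u := (point F u + point F (anti u)).
Local Notation odd u := (point F u - point F (anti u)).

Lemma adjop_point u : A (point F u) = [ffun x => (adj x u)%:R].
Proof.
apply/ffunP => x; rewrite !ffunE big_mkcond (bigD1 u) //= ffunE eqxx big1 ?addr0.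
  by case: (adj x u).
by move=> y yu; rewrite ffunE (negPf yu) if_same.
Qed.

Lemma adjop2_point u :
  A (A (point F u)) = [ffun x => (common_neighbours adj x u)%:R].
Proof.
apply/ffunP => x; rewrite adjop_point !ffunE.
rewrite /common_neighbours -sum1_card natr_sum big_mkcond [RHS]big_mkcond /=.
apply: eq_bigr => y _; rewrite !ffunE inE cover_sym.
by rewrite [adj y u]cover_sym [adj y x]cover_sym; case: (adj x y); case: (adj u y).
Qed.

Lemma adjop_cover_even u : A (even u) = [ffun=> 1] - even u.
Proof.
apply/ffunP => x; rewrite linearD /= !adjop_point !ffunE.
have [->|xu] := eqVneq x u.
  by rewrite cover_irr adj_anti eq_sym anti_neq /=; ring.
have [->|xu'] := eqVneq x (anti u).
  by rewrite cover_irr cover_sym adj_anti /=; ring.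
rewrite addr0 subr0 ![adj x _]cover_sym adj_anti_compl //; last by rewrite eq_sym.
by case: (adj u x); rewrite ?addr0 ?add0r.
Qed.

(** On even vectors [A] acts as the adjacency operator of the complete graph, whose eigenvalues are
    [m - 1] and -1. *)
Lemma adjop2_cover_even u :
  A (A (even u)) = (m.-1%:R - 1) *: A (even u) + m.-1%:R *: even u.
Proof.
have A1 : A [ffun=> 1] = m.-1%:R *: [ffun=> 1].
  apply/ffunP => x; rewrite !ffunE (eq_bigr (fun=> 1)) => [|y _]; last first.
    by rewrite ffunE.
  rewrite sumr_const -(cover_regular x) [RHS]mulr1; congr _%:R.
  by apply: eq_card => y; rewrite [in RHS]inE.
rewrite adjop_cover_even linearB /= A1 adjop_cover_even.
by apply/ffunP => x; rewrite !ffunE /GRing.scale /=; ring.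
Qed.

(** A vertex has [m - 1], [a1], [c2] or 0 common neighbours with [u] at distance 0, 1, 2 or 3.
    Passing to [anti u] reverses this list, so the differences are [m - 1], [delta], [- delta] and
    [1 - m]. *)
Lemma adjop2_cover_odd (delta : int) u : has_delta adj delta ->
  A (A (odd u)) = delta%:~R *: A (odd u) + m.-1%:R *: odd u.
Proof.
move=> [a1 [c2 [adj_a1 dist2_c2 ->]]].
have common_refl x : common_neighbours adj x x = m.-1.
  by rewrite -(cover_regular x); apply: eq_card => y; rewrite !inE andbb.
have common_anti x : common_neighbours adj x (anti x) = 0%N.
  apply: eq_card0 => y; rewrite inE; apply/negP => /andP[xy].
  by rewrite cover_sym anti_no_common.
rewrite intrB; apply/ffunP => x.
rewrite !linearB /= !adjop2_point !adjop_point !ffunE /GRing.scale /=.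
have [e|ux|ux|->] := cover_cases u x.
- rewrite -{}e common_refl common_anti eqxx eq_sym anti_neq cover_irr adj_anti /=.
  ring.
- have d2 := adj_anti_dist2 ux.
  have := d2; rewrite dist2E eq_sym => /and3P[/negPf -> /negPf n2 _].
  have xu : (x == u) = false.
    by apply/negP => /eqP xu; rewrite xu cover_irr in ux.
  have -> : common_neighbours adj x (anti u) = c2.
    by rewrite -(dist2_c2 _ _ d2); apply: eq_card => y; rewrite !inE andbC.
  rewrite adj_a1 ?[adj x u]cover_sym ?ux ?xu ?[adj x _]cover_sym ?n2 //=.
  rewrite -!pmulrn; ring.
- have ux' := dist2_anti ux.
  have := ux; rewrite dist2E eq_sym => /and3P[/negPf -> /negPf n2 _].
  have xu : (x == anti u) = false.
    by apply/negP => /eqP xu; rewrite xu cover_irr in ux'.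
  have -> : common_neighbours adj x u = c2.
    by rewrite -(dist2_c2 _ _ ux); apply: eq_card => y; rewrite !inE andbC.
  rewrite (adj_a1 x) ?[adj x _]cover_sym ?ux' ?xu ?n2 //=.
  rewrite -!pmulrn; ring.
- have := common_anti (anti u); rewrite antiK => ->.
  rewrite common_refl eqxx anti_neq cover_irr cover_sym adj_anti /=.
  ring.
Qed.

End CoverEvolution.
End Cover.

(** The degree is 35. The even adjacency eigenvalues are 35 and -1; the odd ones are the roots 7 and
    -5 of [x^2 = 2x + 35]. *)
Lemma cover36_evolves (F : numFieldType) (V : finType) (adj : rel V)
    (anti : V -> V) (z w : F) (u : V) :
  antipodal_double_cover adj 36 -> has_delta adj 2 -> involutive anti ->
  (forall x y, at_distance adj 3 x y = (y == anti x)) ->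
  z ^+ 36 = 1 -> z ^+ 28 = w -> z ^+ 40 = w ->
  evolves adj z (point F u)
    (((1 + w) / 2) *: point F u + ((1 - w) / 2) *: point F (anti u)).
Proof.
move=> cover delta antiK dist3 z36 z28 z40.
have regular := cover_regular cover dist3.
apply: evolves_antipodal.
  rewrite -[X in evolves _ _ _ X]scale1r.
  apply: (evolves_adj_quadratic regular (i := 0) (j := 36)) => //.
  rewrite (adjop2_cover_even cover dist3); apply/ffunP => x.
  rewrite !ffunE /GRing.scale /=; ring.
apply: (evolves_adj_quadratic regular (i := 28) (j := 40)) => //.
rewrite (adjop2_cover_odd cover antiK dist3 _ _ delta).
by apply/ffunP => x; rewrite !ffunE /GRing.scale /=; ring.
Qed.

(** * State transfer and revival on the product *)

Lemma transition_cartesian_product (R : realType) (V W : finType)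
    (e : rel V) (f : rel W) (t : R) (S : V -> {ffun V -> R[i]^o})
    (S' : W -> {ffun W -> R[i]^o}) :
  (forall u, evolves e (cis t) (point _ u) (S u)) ->
  (forall w, evolves f (cis t) (point _ w) (S' w)) ->
  forall u w, transition (cartesian_product e f) t *m basis_vec R (u, w) =
              col_ffun (tensor (S u) (S' w)).
Proof.
move=> ev ev' u w.
apply: (transition_evolves (S := fun p => tensor (S p.1) (S' p.2))).
by move=> [x y]; rewrite -tensor_point; apply: evolves_tensor.
Qed.

Theorem theorem12p2 (R : realType) (n q : nat) (q_gt0 : (0 < q)%N)
    (q_odd : odd q) (n_def : n = (6 * q)%N)
    (H : 'M[int]_(n ^ 2)) (H_hadamard : hadamard_mx H)
    (VY : finType) (Y : rel VY)
    (Y_cover : antipodal_double_cover Y 36) (Y_delta : has_delta Y 2)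
    (a b : hadamard_vertex (n ^ 2))
    (ab_antipodal : at_distance (hadamard_graph H) 4 a b)
    (c d : VY) (cd_antipodal : at_distance Y 3 c d) :
  let XY := cartesian_product (hadamard_graph H) Y in
  (perfect_state_transfer XY (a, c) (b, c) (pi / 2 : R) /\
   perfect_state_transfer XY (a, d) (b, d) (pi / 2 : R)) /\
  (proper_fractional_revival XY (a, c) (a, d) (pi / 3 : R) /\
   proper_fractional_revival XY (b, c) (b, d) (pi / 3 : R)).
Proof.
move=> XY.
have N_gt0 : (0 < n ^ 2)%N by rewrite n_def expn_gt0 muln_gt0 q_gt0.
have [anti antiK dist3] := cover_antipode Y_cover.
have dc : d = anti c by move: cd_antipodal; rewrite dist3 => /eqP.
have ba : b = antipode a := hadamard_antipode H_hadamard N_gt0 ab_antipodal.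
have ab : a != b.
  by have := at_distance_no_walk (j := 0) ab_antipodal isT; rewrite walk0.
have cd : c != d.
  by have := at_distance_no_walk (j := 0) cd_antipodal isT; rewrite walk0.
have [r qr] : exists r, q = r.*2.+1.
  by exists q./2; rewrite -[LHS]odd_double_half q_odd.
have pihalf4 k : cis (pi / 2 : R) ^+ (4 * k) = 1.
  by rewrite cis_pihalf exprM (exprM _ 2 2) sqr_i sqrrN !expr1n.
have pithird6 k : cis (pi / 3 : R) ^+ (6 * k) = 1.
  by rewrite exprM (exprM _ 3 2) cis_pithird3 sqrrN !expr1n.
have half2 : (1 + 1) / 2 = 1 :> R[i] by field.
have transfer x y :
    transition XY (pi / 2) *m basis_vec R (x, y) = basis_vec R (antipode x, y).
  rewrite (transition_cartesian_product (S := fun x => point _ (antipode x))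
    (S' := point _)).
  - by rewrite tensor_point col_ffun_point.
  - move=> u.
    have := @hadamard_evolves _ _ H_hadamard N_gt0 R[i] n
      (cis (pi / 2)) (-1) u erefl.
    rewrite subrr mul0r scale0r add0r opprK half2 scale1r; apply.
    + by rewrite (_ : (n ^ 2 = 4 * (9 * q ^ 2))%N) //; nia.
    (* As [q] is odd, [n] is 2 modulo 4, and so are [n^2 - n] and [n^2 + n]; the odd phase is
       ['i ^+ 2]. *)
    + rewrite (_ : (n ^ 2 - n = 4 * (36 * r ^ 2 + 33 * r + 7) + 2)%N); last by nia.
      by rewrite exprD pihalf4 mul1r cis_pihalf sqr_i.
    + rewrite (_ : (n ^ 2 + n = 4 * (36 * r ^ 2 + 39 * r + 10) + 2)%N); last by nia.
      by rewrite exprD pihalf4 mul1r cis_pihalf sqr_i.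
  - move=> w.
    have := @cover36_evolves R[i] _ _ _ (cis (pi / 2)) 1 w
      Y_cover Y_delta antiK dist3.
    rewrite subrr mul0r scale0r addr0 half2 scale1r; apply.
    + exact: (pihalf4 9).
    + exact: (pihalf4 7).
    + exact: (pihalf4 10).
pose w := cis (pi / 3 : R) ^+ 4.
have revival x y :
    transition XY (pi / 3) *m basis_vec R (x, y) =
    ((1 + w) / 2) *: basis_vec R (x, y) +
    ((1 - w) / 2) *: basis_vec R (x, anti y).
  rewrite (transition_cartesian_product (S := point _)
    (S' := fun y =>
       ((1 + w) / 2) *: point _ y + ((1 - w) / 2) *: point _ (anti y))).
  - rewrite tensorDr !tensorZr !tensor_point.
    by rewrite col_ffunD !col_ffunZ !col_ffun_point.
  - move=> u.
    have := @hadamard_evolves _ _ H_hadamard N_gt0 R[i] n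
      (cis (pi / 3)) 1 u erefl.
    rewrite subrr mul0r scale0r addr0 half2 scale1r; apply.
    (* Since 6 divides [n], all three exponents are multiples of 6. *)
    + by rewrite (_ : (n ^ 2 = 6 * (6 * q ^ 2))%N) //; nia.
    + by rewrite (_ : (n ^ 2 - n = 6 * (6 * q ^ 2 - q))%N) //; nia.
    + by rewrite (_ : (n ^ 2 + n = 6 * (6 * q ^ 2 + q))%N) //; nia.
  - move=> v; apply: (cover36_evolves _ Y_cover Y_delta antiK dist3).
    + exact: (pithird6 6).
    (* Both 28 and 40 are 4 modulo 6. *)
    + by rewrite (exprD _ (6 * 4) 4) pithird6 mul1r.
    + by rewrite (exprD _ (6 * 6) 4) pithird6 mul1r.
have revival_proper : (1 - w) / 2 != 0.
  (* The cube being -1, [w] is the negative of [cis (pi / 3)], so [w = 1] would make the latter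
     -1. *)
  rewrite mulf_neq0 ?invr_eq0 ?pnatr_eq0 // subr_eq0 /w (exprD _ 3 1).
  by rewrite cis_pithird3 mulN1r expr1 -eqr_oppLR eq_sym cis_pithird_neqN1.
have pst y : perfect_state_transfer XY (a, y) (b, y) (pi / 2 : R).
  exists 0, 1; split; last by [].
  split; first by rewrite xpair_eqE negb_and ab.
  by rewrite transfer -ba scale0r add0r scale1r.
have pfr x : proper_fractional_revival XY (x, c) (x, d) (pi / 3 : R).
  exists ((1 + w) / 2), ((1 - w) / 2); split; last exact: revival_proper.
  split.
    by rewrite xpair_eqE negb_and cd orbT.
  by rewrite revival -dc.
by split; split.
Qed.
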